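(* Let $\phi:\mathbb{R}^n\to\mathbb{R}\cup\{+\infty\}$ be proper, convex and lower semicontinuous, and let $\psi:\mathbb{R}^n\to\mathbb{R}$ be (possibly nonconvex and) Fréchet differentiable with $L$-Lipschitz continuous gradient for some $L>0$. Let $x_0,v_0\in\mathbb{R}^n$ and $\lambda>0$ be such that $v_0\in\partial\phi(x_0)$. Let $(x,v):[0,+\infty)\to\mathbb{R}^n\times\mathbb{R}^n$ be the unique strong global solution of the dynamical system $$\begin{cases} v(t)\in\partial\phi(x(t))\\ \lambda\dot x(t)+\dot v(t)+v(t)+\nabla\psi(x(t))=0\\ x(0)=x_0,\ v(0)=v_0.\end{cases}$$ Suppose that $\phi+\psi$ is bounded from below. Let $(t_k)_{k\in\mathbb{N}}$ be a sequence such that $t_k\to+\infty$ and $x(t_k)\to\overline{x}\in\mathbb{R}^n$ as $k\to+\infty$. Then $$0\in\partial_L(\phi+\psi)(\overline{x}).$$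
   Context: $\mathbb{R}^n$ carries the Euclidean scalar product $\langle\cdot,\cdot\rangle$ and norm $\|\cdot\|$. $\partial\phi$ is the convex subdifferential, $\partial\phi(x)=\{v:\phi(y)\ge\phi(x)+\langle v,y-x\rangle\ \forall y\in\mathbb{R}^n\}$ (empty where $\phi(x)=+\infty$). A function $x:[0,+\infty)\to\mathbb{R}^n$ is locally absolutely continuous if it is absolutely continuous on every interval $[0,T]$, $T>0$. A pair $(x,v)$ is a strong global solution of the system if: $x,v:[0,+\infty)\to\mathbb{R}^n$ are locally absolutely continuous; $v(t)\in\partial\phi(x(t))$ for every $t\ge 0$; $\lambda\dot x(t)+\dot v(t)+v(t)+\nabla\psi(x(t))=0$ for almost every $t\ge 0$; and $x(0)=x_0$, $v(0)=v_0$. (Existence and uniqueness of a strong global solution are known under these assumptions.) For a proper lower semicontinuous $f:\mathbb{R}^n\to\mathbb{R}\cup\{+\infty\}$ and $x$ with $f(x)<+\infty$, the Fréchet subdifferential is $$\hat\partial f(x)=\Big\{v\in\mathbb{R}^n:\liminf_{y\to x}\frac{f(y)-f(x)-\langle v,y-x\rangle}{\|y-x\|}\ge 0\Big\}$$ and the limiting (Mordukhovich) subdifferential is $$\partial_L f(x)=\{v\in\mathbb{R}^n:\exists x_k\to x,\ f(x_k)\to f(x),\ \exists v_k\in\hat\partial f(x_k),\ v_k\to v \text{ as } k\to+\infty\};$$ both are empty if $f(x)=+\infty$. *)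

(* Defs.v *)
From HB Require Import structures.
From mathcomp Require Import all_boot all_order all_algebra.
From mathcomp Require Import all_classical all_reals all_analysis.

Set Implicit Arguments.
Unset Strict Implicit.
Unset Printing Implicit Defensive.

Import Order.TTheory GRing.Theory Num.Theory.
Import numFieldNormedType.Exports.

Local Open Scope classical_set_scope.
Local Open Scope ring_scope.

(* R^n is 'rV[R]_n. The library's norm `|u| on 'rV[R]_n is the sup norm, so the
   Euclidean structure is defined here; the two norms are equivalent, so limits,
   neighbourhoods, semicontinuity, derivatives and Frechet differentiability are
   the library's. *)
Definition dotr (R : realType) (n : nat) (u v : 'rV[R]_n) : R :=
  \sum_(i < n) u 0 i * v 0 i.

Definition enorm (R : realType) (n : nat) (u : 'rV[R]_n) : R :=
  Num.sqrt (dotr u u).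

(* The vector that represents the differential of psi at x. *)
Definition grad (R : realType) (n : nat) (psi : 'rV[R]_n -> R) (x : 'rV[R]_n) :
    'rV[R]_n :=
  \row_(i < n) 'd psi x (delta_mx 0 i).

Lemma dotr_grad (R : realType) (n : nat) (psi : 'rV[R]_n -> R)
    (x h : 'rV[R]_n) :
  dotr (grad psi x) h = 'd psi x h.
Proof.
rewrite [in RHS](row_sum_delta h) linear_sum; apply: eq_bigr => i _.
by rewrite linearZ mxE mulrC.
Qed.

Definition lipschitz_grad (R : realType) (n : nat) (L : R)
    (psi : 'rV[R]_n -> R) : Prop :=
  forall x y : 'rV[R]_n,
    enorm (grad psi x - grad psi y) <= L * enorm (x - y).

Section ExtendedRealFunctions.
Variables (R : realType) (n : nat).
Implicit Types (f : 'rV[R]_n -> \bar R) (x y v : 'rV[R]_n).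
Local Open Scope ereal_scope.

(* A function into R u {+oo} is a function into \bar R that avoids -oo. *)
Definition proper_fun f : Prop :=
  (forall x, -oo < f x) /\ (exists x, f x < +oo).

Definition convex_efun f : Prop :=
  forall x y (t : R), (0 < t < 1)%R ->
    f (t *: x + (1 - t) *: y)%R <= t%:E * f x + (1 - t)%:E * f y.

Definition convex_subdiff f x : set 'rV[R]_n :=
  [set v | f x < +oo /\ forall y, f x + (dotr v (y - x))%:E <= f y].

Definition frechet_subdiff f x : set 'rV[R]_n :=
  [set v | f x < +oo /\
    0 <= limf_einf
      (fun y => (f y - f x - (dotr v (y - x))%:E) * ((enorm (y - x))^-1)%:E)
      x^'].

Definition limiting_subdiff f x : set 'rV[R]_n :=
  [set v | f x < +oo /\
    exists xs vs : nat -> 'rV[R]_n,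
      [/\ xs @ \oo --> x,
          (f \o xs) @ \oo --> f x,
          forall k, frechet_subdiff f (xs k) (vs k) &
          vs @ \oo --> v]].

End ExtendedRealFunctions.

Section Trajectories.
Variables (R : realType) (n : nat).

(* Absolute continuity on [0, T]; only the values of x on [0, T] matter. *)
Definition abs_continuous (T : R) (x : R -> 'rV[R]_n) : Prop :=
  forall e : R, 0 < e -> exists2 d : R, 0 < d &
    forall (m : nat) (a b : 'I_m -> R),
      (forall i, 0 <= a i /\ a i <= b i /\ b i <= T) ->
      trivIset setT (fun i => `]a i, b i[%classic) ->
      \sum_(i < m) (b i - a i) < d ->
      \sum_(i < m) enorm (x (b i) - x (a i)) < e.

Definition loc_abs_continuous (x : R -> 'rV[R]_n) : Prop :=
  forall T : R, 0 < T -> abs_continuous T x.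

(* Functions on [0, +oo[ are functions on R whose values at negative times are
   irrelevant: the two-sided derivative could depend on them only at t = 0,
   which is a null set. *)
Definition strong_global_solution (phi : 'rV[R]_n -> \bar R)
    (psi : 'rV[R]_n -> R) (lambda : R) (x0 v0 : 'rV[R]_n)
    (x v : R -> 'rV[R]_n) : Prop :=
  [/\ loc_abs_continuous x /\ loc_abs_continuous v,
      forall t : R, 0 <= t -> convex_subdiff phi (x t) (v t),
      {ae @lebesgue_measure R, forall t : R, 0 <= t ->
        [/\ derivable x t 1, derivable v t 1 &
            lambda *: derive1 x t + derive1 v t + v t + grad psi (x t) = 0]} &
      x 0 = x0 /\ v 0 = v0].

End Trajectories.

(* Main.v *)
Require Import Defs.
From HB Require Import structures.
From mathcomp Require Import all_boot all_order all_algebra.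
From mathcomp Require Import all_classical all_reals all_analysis.
From mathcomp Require Import measurable_realfun.
From mathcomp Require Import ring lra.

Import Order.TTheory GRing.Theory Num.Theory.
Import numFieldNormedType.Exports.

Local Open Scope classical_set_scope.
Local Open Scope ring_scope.

(** Write w(t) = v(t) + grad psi (x(t)) for the residual, so that the equation
    reads lambda x' + v' + w = 0, and F(t) = phi(x(t)) + psi(x(t)) for the
    energy. If w(t) tends to 0 along the trajectory, then v(t_k) tends to
    - grad psi xbar because the gradient is continuous; the graph of the
    subdifferential of phi is closed ([convex_subdiff_closed]), hence
    - grad psi xbar is a subgradient of phi at xbar, and then 0 is even a
    Frechet subgradient of phi + psi there ([frechet_subdiff_critical]).
    Constant sequences therefore witness the limiting subdifferential.

    That w tends to 0 is a Lyapunov argument. The subdifferential of phi is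
    monotone, so <x', v'> >= 0, and
      F' = <w, x'> = - lambda |x'|^2 - <v', x'> <= - lambda |x'|^2.
    Differentiating |w|^2 / 2 formally, with |(grad psi (x(t)))'| <= L |x'| and
    v' = - w - lambda x', the terms in x' are absorbed by a multiple of F:
    for c = lambda + L^2 / (2 lambda),
      (|w|^2 / 2 + c F)' <= - |w|^2 / 2   ([lyapunov_dissipation]).
    Since F is bounded from below, |w|^2 must be small at arbitrarily late
    times; since F nearly stops decreasing, the decrease of |w|^2 / 2 + c F then
    keeps |w|^2 small for ever ([residual_vanishes]).

    None of the functions F and |w|^2 has to be differentiated, and nothing is
    integrated. For s <= u the increments of F and |w|^2 from s to u are bounded
    from above by expressions in the increments of x and v
    ([lyapunov_increment]), and these bounds, divided by u - s, have a limit
    when s <= t <= u shrink to a time t at which x and v are differentiable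
    ([lyapunov_rate]). Such times are almost all times, and a function
    whose increments are bounded from above by an absolutely continuous cost and
    whose growth rate is nonpositive at almost every time is nonincreasing
    ([ac_nonincreasing]). *)

(** * Monotonicity from almost everywhere information *)

(** Cousin's lemma in the form of a gluing principle: a property of intervals
    that is additive and holds for all short intervals around each point holds
    for the whole interval. The supremum of the points t for which P a t holds
    can neither stop before b nor fail to be attained. *)
Lemma interval_gluing {R : realType} (P : R -> R -> Prop) (a b : R) :
  a <= b ->
  (forall s u t, a <= s -> s <= u -> u <= t -> t <= b ->
    P s u -> P u t -> P s t) ->
  (forall c, a <= c -> c <= b -> exists2 r : R, 0 < r &
    forall s t, a <= s -> s <= c -> c <= t -> t <= b -> t - s < r -> P s t) ->
  P a b.
Proof.
move=> ab glue loc.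
pose A := [set t : R | [/\ a <= t, t <= b & P a t]].
have Aa : A a.
  split=> //; have [r r0 h] := loc a (lexx _) ab.
  by apply: h => //; rewrite subrr.
have supA : has_sup A by split; [exists a | exists b => t []].
set c := sup A.
have ac : a <= c by exact: sup_upper_bound.
have cb : c <= b by apply: ge_sup; [exists a | move=> t []].
have [r r0 h] := loc c ac cb.
have [s [as_ sb Ps] cs] := sup_adherent r0 supA.
have sc : s <= c by apply: sup_upper_bound.
have step t : c <= t -> t <= b -> t - s < r -> A t.
  move=> ct tb tsr; split=> //; first exact: le_trans ct.
  by apply: (glue a s t) => //; [exact: le_trans ct | apply: h].
have [|bsr] := ltP (b - s) r; first by move=> /(step b cb (lexx _)) [].
pose t := (c + (s + r)) / 2.
have ct : c < t by rewrite /t; move: cs; rewrite -/c; lra.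
have ts : t < s + r by rewrite /t; move: cs; rewrite -/c; lra.
have : A t by apply: step; [exact: ltW | lra | lra].
by move=> /(sup_upper_bound supA); rewrite -/c leNgt ct.
Qed.

(** Absolute continuity with an arbitrary cost D s t in place of the norm of an
    increment; [abs_continuous T x] is the case of the Euclidean distance from
    x s to x t. Costs can be added and scaled, which is how the costs of x and v
    combine into a cost that bounds the increments of a Lyapunov function. *)
Definition ac_increments {R : realType} (T : R) (D : R -> R -> R) : Prop :=
  forall e : R, 0 < e -> exists2 d : R, 0 < d &
    forall (m : nat) (a b : 'I_m -> R),
      (forall i, 0 <= a i /\ a i <= b i /\ b i <= T) ->
      trivIset setT (fun i => `]a i, b i[%classic) ->
      \sum_(i < m) (b i - a i) < d ->
      \sum_(i < m) D (a i) (b i) < e.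

Section AcIncrements.
Context {R : realType} (T : R).
Implicit Types D : R -> R -> R.

Lemma ac_incrementsD D1 D2 : ac_increments T D1 -> ac_increments T D2 ->
  ac_increments T (fun s t => D1 s t + D2 s t).
Proof.
move=> h1 h2 e e0; have e20 : 0 < e / 2 by rewrite divr_gt0.
have [d1 d10 {}h1] := h1 _ e20; have [d2 d20 {}h2] := h2 _ e20.
exists (Num.min d1 d2); first by rewrite lt_min d10.
move=> m a b ab tr; rewrite lt_min => /andP[l1 l2].
by rewrite big_split /= (splitr e) ltrD// ?h1 ?h2.
Qed.

Lemma ac_incrementsZ (K : R) D : 0 <= K -> ac_increments T D ->
  ac_increments T (fun s t => K * D s t).
Proof.
move=> K0 h e e0; have K1 : 0 < K + 1 by rewrite ltr_wpDl.
have [d d0 {}h] := h (e / (K + 1)) (divr_gt0 e0 K1).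
exists d => // m a b ab tr l; rewrite -mulr_sumr.
apply: (@le_lt_trans _ _ (K * (e / (K + 1)))).
  by rewrite ler_wpM2l// ltW// h.
by rewrite mulrCA gtr_pMr// ltr_pdivrMr// mul1r ltrDl.
Qed.

(** Gluing concatenates families of intervals, which is natural for lists
    sorted from left to right; sorting is what makes the intervals disjoint. *)
Lemma ac_increments_list D (d e : R) :
  (forall (m : nat) (a b : 'I_m -> R),
      (forall i, 0 <= a i /\ a i <= b i /\ b i <= T) ->
      trivIset setT (fun i => `]a i, b i[%classic) ->
      \sum_(i < m) (b i - a i) < d ->
      \sum_(i < m) D (a i) (b i) < e) ->
  forall l : seq (R * R),
    (forall p, p \in l -> [/\ 0 <= p.1, p.1 <= p.2 & p.2 <= T]) ->
    pairwise (fun p q => p.2 <= q.1) l ->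
    \sum_(p <- l) (p.2 - p.1) < d -> \sum_(p <- l) D p.1 p.2 < e.
Proof.
move=> h l lT pw; rewrite !(big_nth (0, 0)) !big_mkord; apply: h.
  by move=> i; have [] := lT _ (mem_nth (0, 0) (ltn_ord i)).
have ordered (i j : 'I_(size l)) y : (i < j)%N ->
    `](nth (0, 0) l i).1, (nth (0, 0) l i).2[%classic y ->
    `](nth (0, 0) l j).1, (nth (0, 0) l j).2[%classic y -> False.
  move=> ij; rewrite /= !in_itv/= => /andP[_ yi] /andP[yj _].
  have /(pairwiseP (0, 0)) := pw => /(_ i j).
  rewrite !inE => /(_ (ltn_ord i) (ltn_ord j) ij) ll.
  by have := lt_trans yj yi; rewrite ltNge ll.
move=> i j _ _ [y [yi yj]]; apply: val_inj => /=.
by case: (ltngtP i j) => // ij; exfalso;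
  [apply: (ordered i j y) | apply: (ordered j i y)].
Qed.

(** The exceptional null set N is covered by an open set U of measure less than
    d. Around a point of U, a short interval lies in U and is kept in a list;
    around any other point, f grows at rate at most e on short intervals. Gluing
    these local bounds gives a list of disjoint intervals of total length at
    most the measure of U, on which f grows by less than e by absolute
    continuity, while f grows by at most e (b - a) elsewhere. *)
Lemma ac_nonincreasing D (f : R -> R) (a b : R) :
  0 <= a -> a <= b -> b <= T ->
  ac_increments T D ->
  (forall s t : R, 0 <= s -> s <= t -> t <= T -> f t - f s <= D s t) ->
  {ae @lebesgue_measure R, forall c : R, a <= c -> c <= b ->
    forall e : R, 0 < e -> exists2 r : R, 0 < r &
      forall s t, a <= s -> s <= c -> c <= t -> t <= b -> t - s < r ->
        f t - f s <= e * (t - s)} ->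
  f b <= f a.
Proof.
move=> a0 ab bT acD fD [/= N [mN N0 badN]].
suff key e : 0 < e -> f b - f a <= e * (b - a + 1).
  rewrite -subr_le0; apply/ler_addgt0Pr => e e0; rewrite add0r.
  have k0 : 0 < b - a + 1 by rewrite ltr_wpDl// subr_ge0.
  have := key (e / (b - a + 1)) (divr_gt0 e0 k0).
  by rewrite divfK// gt_eqF.
move=> e0; have [d d0 /ac_increments_list hD] := acD _ e0.
have Noo : (lebesgue_measure N < +oo)%E by rewrite N0 ltry.
have [U [oU NU ltd]] := lebesgue_regularity_outer mN Noo d0.
have mU : measurable U by exact: open_measurable.
have muU : (lebesgue_measure U < d%:E)%E.
  rewrite -(setDUK NU) measureU ?setDIK//; last exact: measurableD.
  set mN0 := (X in (X + _)%E); have -> : mN0 = 0%E by exact: N0.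
  by rewrite add0e.
(* The bound by a measure, which is additive in ]s, t], is what survives
   concatenation; the length of the list is compared to d only at the end. *)
pose P s t := exists l : seq (R * R),
  [/\ (forall p, p \in l -> [/\ s <= p.1, p.1 <= p.2 & p.2 <= t]),
      pairwise (fun p q => p.2 <= q.1) l,
      ((\sum_(p <- l) (p.2 - p.1))%:E <=
         lebesgue_measure (U `&` `]s, t]))%E &
      f t - f s <= e * (t - s) + \sum_(p <- l) D p.1 p.2].
have [l [lab pw muL fab]] : P a b.
    apply: interval_gluing => //.
    - move=> s u t as_ su ut tb [l1 [l1s p1 m1 f1]] [l2 [l2s p2 m2 f2]].
      exists (l1 ++ l2); split.
      + move=> p; rewrite mem_cat => /orP[/l1s[? ? /le_trans h]|/l2s[h ? ?]].
          by split=> //; exact: h.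
        by split=> //; exact: le_trans h.
      + rewrite pairwise_cat p1 p2 !andbT; apply/allrelP => p q.
        by move=> /l1s[_ _ /le_trans h] /l2s[/h].
      + rewrite big_cat EFinD /=.
        have -> : `]s, t]%classic = `]s, u] `|` `]u, t].
          by rewrite -itv_bndbnd_setU ?bnd_simp.
        rewrite setIUr measureU.
        * exact: leeD.
        * exact: measurableI.
        * exact: measurableI.
        * rewrite setIACA setIid -subset0 => y [_ /= []].
          by rewrite !in_itv/= => /andP[_ yu] /andP[/lt_le_trans /(_ yu)];
            rewrite ltxx.
      + rewrite big_cat /=.
        by move: f1 f2; lra.
    - move=> c ac cb; have [Uc|nUc] := pselect (U c).
        have /nbhs_ballP[r /= r0 rU] : nbhs c U by exact: open_nbhs_nbhs.
        exists r => // s t as_ sc ct tb ts; exists [:: (s, t)].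
        have st := le_trans sc ct.
        split=> //=.
        + by move=> p; rewrite inE => /eqP->.
        + rewrite big_seq1 /= (_ : U `&` _ = `]s, t]%classic).
            by rewrite lebesgue_measure_itv/= lte_fin; case: ltP => //;
              rewrite lee_fin; move: st; lra.
          apply/setIidPr => y /=; rewrite in_itv/= => /andP[sy yt].
          apply: rU; rewrite /ball/= ltr_norml; apply/andP; split; lra.
        + rewrite big_seq1 /=; have := fD s t.
          have : 0 <= e * (t - s) by rewrite mulr_ge0 ?subr_ge0// ltW.
          have := le_trans a0 as_; have := le_trans tb bT.
          by move=> h1 h2 h3 /(_ h2 st h1); lra.
      have : ~ (~` [set t | _]) c := fun h => nUc (NU _ (badN _ h)).
      move=> /contrapT /(_ ac cb e e0)[r r0 hr].
      exists r => // s t as_ sc ct tb ts; exists [::]; split=> //.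
        by rewrite big_nil.
      by rewrite big_nil addr0; exact: hr.
have := hD l; rewrite mulrDr mulr1 => hDl; apply: (le_trans fab).
rewrite lerD2l ltW// hDl//.
  move=> p /lab[h1 h2 h3].
  by split=> //; [exact: le_trans h1 | exact: le_trans bT].
rewrite -lte_fin; apply: le_lt_trans muL _.
apply: le_lt_trans muU; apply: le_measure; rewrite ?inE//.
by apply: measurableI.
Qed.

End AcIncrements.

(** * Euclidean geometry of row vectors *)

Section Euclidean.
Context {R : realType} {n : nat}.
Implicit Types (u v w : 'rV[R]_n) (k : R).

Lemma dotrC u v : dotr u v = dotr v u.
Proof. by apply: eq_bigr => i _; rewrite mulrC. Qed.

Lemma dotrDl u v w : dotr (u + v) w = dotr u w + dotr v w.
Proof. by rewrite -big_split; apply: eq_bigr => i _; rewrite mxE mulrDl. Qed.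

Lemma dotrDr u v w : dotr w (u + v) = dotr w u + dotr w v.
Proof. by rewrite ![dotr w _]dotrC dotrDl. Qed.

Lemma dotrZl k u v : dotr (k *: u) v = k * dotr u v.
Proof. by rewrite mulr_sumr; apply: eq_bigr => i _; rewrite mxE mulrA. Qed.

Lemma dotrZr k u v : dotr u (k *: v) = k * dotr u v.
Proof. by rewrite dotrC dotrZl dotrC. Qed.

Lemma dotrNl u v : dotr (- u) v = - dotr u v.
Proof. by rewrite -scaleN1r dotrZl mulN1r. Qed.

Lemma dotrNr u v : dotr u (- v) = - dotr u v.
Proof. by rewrite dotrC dotrNl dotrC. Qed.

Lemma dotrBl u v w : dotr (u - v) w = dotr u w - dotr v w.
Proof. by rewrite dotrDl dotrNl. Qed.

Lemma dotrBr u v w : dotr w (u - v) = dotr w u - dotr w v.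
Proof. by rewrite dotrDr dotrNr. Qed.

Lemma dotr0 u : dotr u 0 = 0.
Proof. by rewrite -(scale0r u) dotrZr mul0r. Qed.

Lemma dotr_ge0 u : 0 <= dotr u u.
Proof. by apply: sumr_ge0 => i _; rewrite -expr2 sqr_ge0. Qed.

Lemma enorm_ge0 u : 0 <= enorm u.
Proof. exact: sqrtr_ge0. Qed.

Lemma sqr_enorm u : enorm u ^+ 2 = dotr u u.
Proof. by rewrite sqr_sqrtr ?dotr_ge0. Qed.

Lemma enormN u : enorm (- u) = enorm u.
Proof. by rewrite /enorm dotrNl dotrNr opprK. Qed.

Lemma enorm_distC u v : enorm (u - v) = enorm (v - u).
Proof. by rewrite -opprB enormN. Qed.

Lemma enorm0 : enorm (0 : 'rV[R]_n) = 0.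
Proof. by rewrite /enorm dotr0 sqrtr0. Qed.

Lemma enormZ k u : enorm (k *: u) = `|k| * enorm u.
Proof.
by rewrite /enorm dotrZl dotrZr mulrA -expr2 sqrtrM ?sqr_ge0// sqrtr_sqr.
Qed.

(** The sup norm of the topology on row vectors is dominated by the Euclidean
    norm: Euclidean convergence implies convergence. *)
Lemma norm_le_enorm u : `|u| <= enorm u.
Proof.
have [u0|u0] := eqVneq (mx_norm u) 0; first by rewrite /Num.norm/= u0 enorm_ge0.
have [[j i] /= uE] := mx_norm_neq0 u0; rewrite /Num.norm/= uE (ord1 j).
rewrite -sqrtr_sqr ler_wsqrtr// /dotr (bigD1 i)//= -expr2 lerDl.
by apply: sumr_ge0 => k _; rewrite -expr2 sqr_ge0.
Qed.

Lemma enorm_eq0 u : (enorm u == 0) = (u == 0).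
Proof.
apply/idP/idP => [/eqP u0|/eqP->]; last by rewrite enorm0.
by rewrite -normr_le0 -u0 norm_le_enorm.
Qed.

(** Cauchy-Schwarz, from the square of the norm of |v| u - |u| v. *)
Lemma dotr_le_enorm u v : dotr u v <= enorm u * enorm v.
Proof.
have [->|u0] := eqVneq u 0; first by rewrite dotrC dotr0 enorm0 mul0r.
have [->|v0] := eqVneq v 0; first by rewrite dotr0 enorm0 mulr0.
have uv : 0 < enorm u * enorm v.
  by rewrite mulr_gt0// lt_neqAle enorm_ge0 eq_sym enorm_eq0 ?u0 ?v0.
have := dotr_ge0 (enorm v *: u - enorm u *: v).
rewrite !(dotrBl, dotrBr, dotrZl, dotrZr) (dotrC v u) -!sqr_enorm.
rewrite (_ : _ - _ = 2 * (enorm u * enorm v) * (enorm u * enorm v - dotr u v)).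
  by rewrite (pmulr_rge0 _ (mulr_gt0 (ltr0n R 2) uv)) subr_ge0.
by ring.
Qed.

Lemma sqr_enorm_increment u v :
  enorm u ^+ 2 - enorm v ^+ 2 <= 2 * dotr u (u - v).
Proof.
have := dotr_ge0 (u - v).
by rewrite !sqr_enorm dotrBl !dotrBr (dotrC v u); lra.
Qed.

Lemma normr_dotr_le u v : `|dotr u v| <= enorm u * enorm v.
Proof. by rewrite ler_norml lerNl -dotrNl -{1}(enormN u) !dotr_le_enorm. Qed.

Lemma enormD u v : enorm (u + v) <= enorm u + enorm v.
Proof.
rewrite -(@ler_pXn2r _ 2)// ?nnegrE ?addr_ge0 ?enorm_ge0//.
rewrite sqrrD !sqr_enorm dotrDl !dotrDr (dotrC v u).
by have := dotr_le_enorm u v; lra.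
Qed.

Lemma enormB u v : enorm (u - v) <= enorm u + enorm v.
Proof. by rewrite -(enormN v) enormD. Qed.

Section Limits.
Context {T : Type} {F : set_system T} {FF : Filter F}.
Implicit Types f g : T -> 'rV[R]_n.

Lemma cvg_coord f u (i : 'I_n) :
  f @ F --> u -> (fun z => f z 0 i) @ F --> u 0 i.
Proof.
by move=> fu; apply: (cvg_comp f (fun M => M 0 i) fu); exact: coord_continuous.
Qed.

Lemma cvg_dotr {f g u v} : f @ F --> u -> g @ F --> v ->
  (fun z => dotr (f z) (g z)) @ F --> dotr u v.
Proof.
move=> fu gv; apply: cvg_big; first exact: add_continuous.
move=> i _; apply: cvgM.
  exact: cvg_coord.
exact: cvg_coord.
Qed.

Lemma cvg_enorm {f u} : f @ F --> u -> (fun z => enorm (f z)) @ F --> enorm u.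
Proof.
move=> fu.
have h : (fun z => dotr (f z) (f z)) @ F --> dotr u u by exact: cvg_dotr.
apply: (cvg_comp _ (@Num.sqrt R) h); exact: sqrt_continuous.
Qed.

Lemma enorm_cvg f u : (fun z => enorm (u - f z)) @ F --> 0 -> f @ F --> u.
Proof.
move=> /cvgrPdist_lt h; apply/cvgrPdist_lt => e e0.
near=> z; apply: (le_lt_trans (norm_le_enorm _)).
have : `|0 - enorm (u - f z)| < e by near: z; exact: h.
by rewrite sub0r normrN ger0_norm// enorm_ge0.
Unshelve. all: by end_near. Qed.

End Limits.
End Euclidean.

(** * Functions with Lipschitz continuous gradient *)

Section Descent.
Context {R : realType} {n : nat} (psi : 'rV[R]_n -> R).
Hypothesis psi_diff : forall y, differentiable psi y.

Lemma mean_value_segment (y z : 'rV[R]_n) :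
  exists2 th : R, 0 <= th <= 1 &
    psi y - psi z = dotr (grad psi (z + th *: (y - z))) (y - z).
Proof.
set h := y - z; pose g (th : R) := psi (z + th *: h).
have dg (th : R) : is_derive th (1 : R) g (dotr (grad psi (z + th *: h)) h).
  have dpsi := psi_diff (z + th *: h).
  have E : (fun e : R => e^-1 *: (g (e *: (1 : R) + th) - g th)) =
           (fun e : R => e^-1 *:
              (psi (e *: h + (z + th *: h)) - psi (z + th *: h))).
    apply/funext => e; congr (_ *: (psi _ - _)).
    by rewrite scalerDl /GRing.scale/= mulr1 addrCA.
  apply: DeriveDef; first by rewrite /derivable E; exact: diff_derivable.
  by rewrite dotr_grad -deriveE// /derive E.
have [|th] := @MVT_segment R g _ 0 1 ler01 (fun th _ => dg th).
  apply: continuous_subspaceT => th.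
  by apply: differentiable_continuous; apply/derivable1_diffP; case: (dg th).
rewrite in_itv/= => th01; rewrite subr0 mulr1 /g scale1r scale0r addr0.
by rewrite /h subrKC => ?; exists th.
Qed.

(** By the mean value theorem, only the gradients at z and at one point between
    z and y are compared, whence L instead of the sharp constant L / 2. *)
Lemma quadratic_bound (L : R) (y z : 'rV[R]_n) : 0 <= L ->
  lipschitz_grad L psi ->
  `|psi y - psi z - dotr (grad psi z) (y - z)| <= L * enorm (y - z) ^+ 2.
Proof.
move=> L0 lip; have [th /andP[th0 th1] ->] := mean_value_segment y z.
rewrite -dotrBl; apply: (le_trans (normr_dotr_le _ _)).
rewrite expr2 mulrA ler_wpM2r ?enorm_ge0//; apply: (le_trans (lip _ _)).
rewrite addrC addKr enormZ ger0_norm// ler_wpM2l//.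
by rewrite ler_piMl// enorm_ge0.
Qed.

Lemma cvg_grad (L : R) {T : Type} {F : set_system T} {FF : Filter F}
    (f : T -> 'rV[R]_n) (a : 'rV[R]_n) :
  lipschitz_grad L psi -> f @ F --> a ->
  (fun z => grad psi (f z)) @ F --> grad psi a.
Proof.
move=> lip fa; apply: enorm_cvg.
apply: (@squeeze_cvgr _ _ _ _ (fun=> 0) (fun z => L * enorm (a - f z))).
- by apply: nearW => z; rewrite enorm_ge0 lip.
- exact: cvg_cst.
- have : L * enorm (a - f z) @[z --> F] --> L * enorm (a - a).
    apply: cvgM; first exact: cvg_cst.
    by apply: cvg_enorm; apply: cvgB => //; exact: cvg_cst.
  by rewrite subrr enorm0 mulr0.
Qed.

End Descent.

(** * Difference quotients over intervals around a time *)

Section Straddle.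
Context {R : realType}.

(** Intervals [s, u] with s <= t <= u that shrink to t, restricted to times
    s >= 0 because nothing is known of the trajectory at negative times. *)
Definition straddling (t : R) : set_system (R * R) :=
  fun A => exists2 r : R, 0 < r & forall s u : R,
    0 <= s -> s <= t -> t <= u -> s < u -> u - s < r -> A (s, u).

Lemma straddling_filter (t : R) : Filter (straddling t).
Proof.
split.
- by exists 1.
- move=> A B [r1 r10 h1] [r2 r20 h2]; exists (Num.min r1 r2).
    by rewrite lt_min r10.
  move=> s u s0 st tu su; rewrite lt_min => /andP[l1 l2].
  by split; [exact: h1 | exact: h2].
- by move=> A B AB [r r0 h]; exists r => // s u *; apply: AB; exact: h.
Qed.

#[local] Existing Instance straddling_filter.

Lemma cvg_straddling_right {T : topologicalType} (t : R) (f : R -> T) :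
  {for t, continuous f} -> (fun z => f z.2) @ straddling t --> f t.
Proof.
move=> ft A /ft /nbhs_ballP[r /= r0 rA]; exists r => // s u _ st tu _ us.
by apply: rA; rewrite /ball/= ltr_norml; apply/andP; split; lra.
Qed.

Lemma cvg_straddling_left {T : topologicalType} (t : R) (f : R -> T) :
  {for t, continuous f} -> (fun z => f z.1) @ straddling t --> f t.
Proof.
move=> ft A /ft /nbhs_ballP[r /= r0 rA]; exists r => // s u _ st tu _ us.
by apply: rA; rewrite /ball/= ltr_norml; apply/andP; split; lra.
Qed.

Lemma derivable_continuous_at {V : normedModType R} (t : R) (f : R -> V) :
  derivable f t 1 -> {for t, continuous f}.
Proof.
by move=> df; apply: differentiable_continuous; apply/derivable1_diffP.
Qed.

(** The first order errors at s and u are at most e (t - s) and e (u - t), which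
    add up to e (u - s) as t lies between s and u. *)
Lemma cvg_straddling_slope {V : normedModType R} (t : R) (f : R -> V) :
  derivable f t 1 ->
  (fun z => (z.2 - z.1)^-1 *: (f z.2 - f z.1)) @ straddling t --> derive1 f t.
Proof.
move=> ft; apply/cvgrPdist_le => e e0.
have : (fun h : R => h^-1 *: (f (h + t) - f t)) @ 0^' --> derive1 f t.
  by rewrite derive1E; move: ft; rewrite /derivable /derive /= ;
    under eq_fun do rewrite [_ *: 1]mulr1.
move=> /cvgrPdist_le /(_ e e0)[r /= r0 hr].
have lin (h : R) : `|h| < r ->
    `|f (h + t) - f t - h *: derive1 f t| <= e * `|h|.
  move=> hh; have [->|h0] := eqVneq h 0.
    by rewrite add0r subrr scale0r subr0 !normr0 mulr0.
  have := hr h; rewrite /ball_/= sub0r normrN => /(_ hh h0) le_e.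
  rewrite (_ : _ - _ = - (h *: (derive1 f t - h^-1 *: (f (h + t) - f t)))).
    by rewrite normrN normrZ mulrC ler_wpM2r.
  by rewrite scalerBr scalerA divff// scale1r opprB.
exists r => // s u s0 st tu su usr /=.
have us0 : 0 < u - s by rewrite subr_gt0.
rewrite -(@ler_pM2l _ (u - s))//.
rewrite -{1}(gtr0_norm us0) -normrZ scalerBr scalerA divff ?gt_eqF// scale1r.
have /lin lu : `|u - t| < r by rewrite ger0_norm; lra.
have /lin ls : `|s - t| < r by rewrite ler0_norm; lra.
move: lu ls; rewrite !subrK (@ger0_norm _ (u - t)) ?subr_ge0//.
rewrite (@ler0_norm _ (s - t)) ?subr_le0// => lu ls.
rewrite (_ : _ - _ = (f s - f t - (s - t) *: derive1 f t) -
                     (f u - f t - (u - t) *: derive1 f t)).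
  by apply: (le_trans (ler_normB _ _)); move: lu ls; lra.
have -> : u - s = (u - t) - (s - t) by ring.
have -> : f u - f s = (f u - f t) - (f s - f t).
  by rewrite opprB addrA subrK.
by rewrite scalerBl !opprB addrACA [in RHS]addrACA (addrC (f s - f t)).
Qed.

End Straddle.

#[local] Existing Instance straddling_filter.

(** * Boundedness of absolutely continuous curves *)

Section AbsContinuous.
Context {R : realType}.

Lemma ac_increments_small (T e : R) (D : R -> R -> R) :
  ac_increments T D -> 0 < e -> exists2 d : R, 0 < d &
    forall a b, 0 <= a -> a <= b -> b <= T -> b - a < d -> D a b < e.
Proof.
move=> acD e0; have [d d0 /ac_increments_list hd] := acD e e0.
exists d => // a b a0 ab bT bad.
have := hd [:: (a, b)]; rewrite !big_seq1 /=; apply => //.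
by move=> p; rewrite inE => /eqP->.
Qed.

Lemma ac_increments_length (T : R) : ac_increments T (fun s t => t - s).
Proof. by move=> e e0; exists e. Qed.

Lemma abs_continuous_bounded {n} (T : R) (y : R -> 'rV[R]_n) : 0 <= T ->
  abs_continuous T y ->
  exists B : R, forall t, 0 <= t -> t <= T -> enorm (y t) <= B.
Proof.
move=> T0 acy; have [d d0 hd] :=
  ac_increments_small T 1 (fun s t => enorm (y t - y s)) acy ltr01.
apply: (interval_gluing (fun s t =>
  exists B : R, forall r, s <= r -> r <= t -> enorm (y r) <= B)) => //.
- move=> s u t s0 su ut tT [B1 h1] [B2 h2]; exists (Num.max B1 B2) => r sr rt.
  rewrite le_max; have [ru|ur] := leP r u; first by rewrite h1.
  by rewrite h2 ?orbT// ltW.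
- move=> c c0 cT; exists d => // s t s0 sc ct tT ts; exists (enorm (y c) + 1).
  move=> r sr rt; have yrc : enorm (y r - y c) <= 1.
    have [rc|/ltW cr] := leP r c.
      by rewrite enorm_distC; apply/ltW/hd => //; move: s0 sr rc ct ts; lra.
    by apply/ltW/hd => //; move: sc cr tT rt ts; lra.
  by have := enormD (y c) (y r - y c); rewrite subrKC; lra.
Qed.

End AbsContinuous.

(** * Dissipation along a trajectory *)

Section Trajectory.
Context {R : realType} {n : nat}.
Variables (phi : 'rV[R]_n -> \bar R) (psi : 'rV[R]_n -> R) (L lambda : R).
Variables x v : R -> 'rV[R]_n.
Hypothesis phi_proper : proper_fun phi.
Hypothesis psi_diff : forall y, differentiable psi y.
Hypothesis L_ge0 : 0 <= L.
Hypothesis grad_lip : lipschitz_grad L psi.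
Hypothesis lambda_gt0 : 0 < lambda.
Hypothesis xv_subdiff : forall t, 0 <= t -> convex_subdiff phi (x t) (v t).

Definition energy (t : R) : R := fine (phi (x t)) + psi (x t).

Definition residual (t : R) : 'rV[R]_n := v t + grad psi (x t).

(** The two functions to be shown to decrease are the energy (al = 0, c = 1) and
    the Lyapunov function (al = 1, c = lyapunov_weight). *)
Definition lyapunov (al c t : R) : R :=
  al / 2 * enorm (residual t) ^+ 2 + c * energy t.

Definition good_time (t : R) : Prop :=
  [/\ derivable x t 1, derivable v t 1 &
      lambda *: derive1 x t + derive1 v t + v t + grad psi (x t) = 0].

Lemma phi_fin t : 0 <= t -> phi (x t) \is a fin_num.
Proof.
move=> t0; have [xoo _] := xv_subdiff t t0.
by rewrite fin_numElt xoo andbT; case: phi_proper.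
Qed.

Lemma subdiff_increment s u : 0 <= s -> 0 <= u ->
  dotr (v s) (x u - x s) <= fine (phi (x u)) - fine (phi (x s)).
Proof.
move=> s0 u0; have [_ /(_ (x u))] := xv_subdiff s s0.
rewrite -(fineK (phi_fin s s0)) -(fineK (phi_fin u u0)) -EFinD lee_fin.
by lra.
Qed.

Lemma subdiff_monotone s u : 0 <= s -> 0 <= u ->
  0 <= dotr (x u - x s) (v u - v s).
Proof.
move=> s0 u0; have := subdiff_increment s u s0 u0.
have := subdiff_increment u s u0 s0.
by rewrite -(opprB (x u)) dotrNr (dotrC (x u - x s)) dotrBl; lra.
Qed.

(** Convexity of phi at x(u) and the quadratic bound for psi around x(u). Taking
    the subgradient at the endpoint u, rather than s, makes the same vector w(u)
    appear here and in [residual_increment]. *)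
Lemma energy_increment s u : 0 <= s -> 0 <= u ->
  energy u - energy s <=
    dotr (residual u) (x u - x s) + L * enorm (x u - x s) ^+ 2.
Proof.
move=> s0 u0; have := subdiff_increment u s u0 s0.
have := quadratic_bound psi psi_diff L (x s) (x u) L_ge0 grad_lip.
rewrite ler_norml => /andP[+ _].
rewrite /energy /residual -(opprB (x u)) enormN !dotrNr dotrDl; lra.
Qed.

(** The expansion |a|^2 - |b|^2 <= 2 <a, a - b> with a = w(u), b = w(s); the
    increment of grad psi o x enters only through its Lipschitz bound, so this
    curve need not be differentiable. *)
Lemma residual_increment s u :
  enorm (residual u) ^+ 2 - enorm (residual s) ^+ 2 <=
    2 * (dotr (residual u) (v u - v s) +
         L * enorm (residual u) * enorm (x u - x s)).
Proof.
apply: (le_trans (sqr_enorm_increment _ _)); rewrite ler_pM2l//.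
have -> : residual u - residual s =
    (v u - v s) + (grad psi (x u) - grad psi (x s)).
  by rewrite /residual opprD addrACA.
rewrite dotrDr lerD2l; apply: (le_trans (dotr_le_enorm _ _)).
by rewrite -mulrA mulrCA ler_wpM2l ?enorm_ge0//; exact: grad_lip.
Qed.

Lemma residual_continuous t : good_time t -> {for t, continuous residual}.
Proof.
move=> [dx dv _]; have cx : {for t, continuous x}.
  exact: derivable_continuous_at.
have cv : {for t, continuous v}.
  exact: derivable_continuous_at.
by apply: cvgD; [exact: cv | exact: (cvg_grad psi L)].
Qed.

Lemma residual_eq t : good_time t ->
  residual t = - (lambda *: derive1 x t + derive1 v t).
Proof.
by move=> [_ _ /eqP]; rewrite -addrA addr_eq0 => /eqP ->; rewrite opprK.
Qed.

#[local] Opaque residual energy.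

Lemma lyapunov_increment al c s u : 0 <= al -> 0 <= c -> 0 <= s -> 0 <= u ->
  lyapunov al c u - lyapunov al c s <=
    al * (dotr (residual u) (v u - v s) +
          L * enorm (residual u) * enorm (x u - x s)) +
    c * (dotr (residual u) (x u - x s) + L * enorm (x u - x s) ^+ 2).
Proof.
move=> al0 c0 s0 u0.
have combine (a b p a' b' q : R) : a - b <= 2 * p -> a' - b' <= q ->
    al / 2 * a + c * a' - (al / 2 * b + c * b') <= al * p + c * q.
  by move=> /(ler_wpM2l al0) + /(ler_wpM2l c0); lra.
by apply: combine; [exact: residual_increment | exact: energy_increment].
Qed.

(** Limit of <x(u) - x(s), v(u) - v(s)> >= 0 divided by (u - s)^2. *)
Lemma velocities_monotone t : 0 <= t -> good_time t ->
  0 <= dotr (derive1 x t) (derive1 v t).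
Proof.
move=> t0 [dx dv _]; rewrite leNgt; apply/negP.
move=> /(cvgr_lt _ (cvg_dotr (cvg_straddling_slope t x dx)
  (cvg_straddling_slope t v dv)))[r r0 hr].
have tr : t < t + r / 2 by rewrite ltrDl divr_gt0.
have := hr t (t + r / 2) t0 (lexx t) (ltW tr) tr; rewrite addrAC subrr add0r.
have r2 : r / 2 < r by rewrite ltr_pdivrMr// ltr_pMr// ltr1n.
have ir : 0 <= (r / 2)^-1 by rewrite invr_ge0 divr_ge0// ltW.
move=> /(_ r2); rewrite ltNge => /negP; apply.
rewrite dotrZl dotrZr !mulr_ge0// subdiff_monotone//.
by rewrite addr_ge0// divr_ge0// ltW.
Qed.

(** The left-hand side of the hypothesis is the limit of the bound of
    [lyapunov_increment] divided by u - s: the quadratic term in x(u) - x(s)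
    disappears, since x is continuous at t. *)
Lemma lyapunov_rate al c t : 0 <= al -> 0 <= c -> 0 <= t -> good_time t ->
  forall e : R, 
      al * (dotr (residual t) (derive1 v t) +
            L * enorm (residual t) * enorm (derive1 x t)) +
      c * dotr (residual t) (derive1 x t) < e ->
  exists2 r : R, 0 < r & forall s u : R, 0 <= s -> s <= t -> t <= u ->
    u - s < r -> lyapunov al c u - lyapunov al c s <= e * (u - s).
Proof.
move=> al0 c0 t0 gt e; have [dx dv _] := gt.
have cw := cvg_straddling_right t residual (residual_continuous t gt).
have cx : {for t, continuous x}.
  exact: derivable_continuous_at.
have xr := cvg_straddling_right t x cx; have xl := cvg_straddling_left t x cx.
have sx := cvg_straddling_slope t x dx; have sv := cvg_straddling_slope t v dv.
pose B (z : R * R) :=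
  al * (dotr (residual z.2) ((z.2 - z.1)^-1 *: (v z.2 - v z.1)) +
    L * enorm (residual z.2) * enorm ((z.2 - z.1)^-1 *: (x z.2 - x z.1))) +
  c * (dotr (residual z.2) ((z.2 - z.1)^-1 *: (x z.2 - x z.1)) +
    L * (enorm ((z.2 - z.1)^-1 *: (x z.2 - x z.1)) * enorm (x z.2 - x z.1))).
set l := (X in X < e) => le.
have Bl : B @ straddling t --> l.
  have -> : l = al * (dotr (residual t) (derive1 v t) +
        L * enorm (residual t) * enorm (derive1 x t)) +
      c * (dotr (residual t) (derive1 x t) +
        L * (enorm (derive1 x t) * enorm (x t - x t))).
    by rewrite subrr enorm0 !mulr0 addr0.
  have nw := cvg_enorm cw; have nx := cvg_enorm sx.
  have nd := cvg_enorm (cvgB xr xl).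
  apply: cvgD; (apply: cvgM; first exact: cvg_cst); apply: cvgD.
  - exact: (cvg_dotr cw sv).
  - by apply: cvgM; [apply: cvgM; [exact: cvg_cst | exact: nw] | exact: nx].
  - exact: (cvg_dotr cw sx).
  - by apply: cvgM; [exact: cvg_cst | apply: cvgM; [exact: nx | exact: nd]].
have [r r0 hr] := cvgr_lt _ Bl _ le.
exists r => // s u s0 st tu usr.
have [su|su] := ltP s u; last first.
  have -> : u = s by apply: le_anti; rewrite su (le_trans st).
  by rewrite !subrr mulr0.
have us0 : 0 < u - s by rewrite subr_gt0.
apply: (le_trans (lyapunov_increment _ _ s u al0 c0 s0 _)).
  exact: le_trans tu.
apply: (@le_trans _ _ (B (s, u) * (u - s))); last first.
  by rewrite ler_wpM2r ?ltW//; exact: hr.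
have i0 : 0 <= (u - s)^-1 by rewrite invr_ge0 ltW.
rewrite /B /= !enormZ !dotrZr (ger0_norm i0).
rewrite le_eqVlt; apply/orP; left; apply/eqP.
move: (enorm _) (enorm _) (dotr _ _) (dotr _ _) => a1 a2 a3 a4.
by field; rewrite gt_eqF.
Qed.

Hypothesis x_ac : loc_abs_continuous x.
Hypothesis v_ac : loc_abs_continuous v.

Lemma residual_bounded (T : R) : 0 < T -> exists B : R, forall t,
  0 <= t -> t <= T -> enorm (residual t) <= B /\ enorm (x t) <= B.
Proof.
move=> T0; have [Bx hx] := abs_continuous_bounded T x (ltW T0) (x_ac T T0).
have [Bv hv] := abs_continuous_bounded T v (ltW T0) (v_ac T T0).
exists (Num.max Bx (Bv + (L * Bx + enorm (grad psi 0)))) => t t0 tT.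
split; last by rewrite le_max hx.
rewrite le_max; apply/orP; right.
apply: (le_trans (enormD _ _)); apply: lerD; first exact: hv.
rewrite -[grad psi (x t)](subrK (grad psi 0)).
apply: (le_trans (enormD _ _)); rewrite lerD2r.
apply: (le_trans (grad_lip _ _)); rewrite subr0 ler_wpM2l//.
exact: hx.
Qed.

(** On a bounded time interval the factors w(u) and x(u) - x(s) of
    [lyapunov_increment] are bounded, which makes the bound linear in the
    increments of x and v. *)
Lemma lyapunov_increment_le al c (T : R) : 0 <= al -> 0 <= c -> 0 < T ->
  exists2 K : R, 0 <= K & forall s u, 0 <= s -> s <= u -> u <= T ->
    lyapunov al c u - lyapunov al c s <=
      K * (enorm (x u - x s) + enorm (v u - v s)).
Proof.
move=> al0 c0 T0; have [B hB] := residual_bounded T T0.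
have B0 : 0 <= B.
  by have [+ _] := hB 0 (lexx _) (ltW T0); apply: le_trans; exact: enorm_ge0.
pose K := al * B + (al * (L * B) + c * B + c * (L * (2 * B))).
have K1 : 0 <= al * B by rewrite mulr_ge0.
have K2 : 0 <= al * (L * B) by rewrite !mulr_ge0.
have K3 : 0 <= c * B by rewrite mulr_ge0.
have K4 : 0 <= c * (L * (2 * B)) by rewrite !mulr_ge0.
exists K => [|s u s0 su uT]; first by rewrite /K !addr_ge0.
have u0 := le_trans s0 su; have sT := le_trans su uT.
apply: (le_trans (lyapunov_increment _ _ s u al0 c0 s0 u0)).
have combine (r dx dv pv px : R) : 0 <= dx -> 0 <= dv -> dx <= 2 * B ->
    r <= B -> pv <= r * dv -> px <= r * dx ->
    al * (pv + L * r * dx) + c * (px + L * dx ^+ 2) <= K * (dx + dv).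
  move=> dx0 dv0 dxB rB pvr pxr.
  have pvB : pv <= B * dv by apply: (le_trans pvr); rewrite ler_wpM2r.
  have pxB : px <= B * dx by apply: (le_trans pxr); rewrite ler_wpM2r.
  have qB : L * r * dx <= L * B * dx by rewrite ler_wpM2r// ler_wpM2l.
  have sB : L * dx ^+ 2 <= L * (2 * B) * dx.
    by rewrite expr2 mulrA ler_wpM2r// ler_wpM2l.
  apply: (@le_trans _ _ (al * (B * dv + L * B * dx) +
                        c * (B * dx + L * (2 * B) * dx))).
    by apply: lerD; rewrite ler_wpM2l// lerD.
  have h1 := mulr_ge0 K1 dx0; have h2 := mulr_ge0 K2 dv0.
  by have h3 := mulr_ge0 K3 dv0; have h4 := mulr_ge0 K4 dv0; rewrite /K; lra.
apply: combine; rewrite ?enorm_ge0 ?dotr_le_enorm//.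
- apply: (le_trans (enormB _ _)); rewrite mulr2n mulrDl mul1r.
  by apply: lerD; [exact: (hB u u0 uT).2 | exact: (hB s s0 sT).2].
- exact: (hB u u0 uT).1.
Qed.

Hypothesis good_ae :
  {ae @lebesgue_measure R, forall t : R, 0 <= t -> good_time t}.

Lemma lyapunov_decrease al c eta a b :
  0 <= al -> 0 <= c -> 0 <= eta -> 0 <= a -> a <= b ->
  (forall t, a <= t -> t <= b -> good_time t ->
      al * (dotr (residual t) (derive1 v t) +
            L * enorm (residual t) * enorm (derive1 x t)) +
      c * dotr (residual t) (derive1 x t) <= - eta) ->
  lyapunov al c b + eta * b <= lyapunov al c a + eta * a.
Proof.
move=> al0 c0 eta0 a0 ab rate.
have T0 : 0 < b + 1 by rewrite ltr_wpDl// (le_trans a0).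
have [K K0 hK] := lyapunov_increment_le al c (b + 1) al0 c0 T0.
apply: (ac_nonincreasing (b + 1) (fun s t =>
  K * (enorm (x t - x s) + enorm (v t - v s)) + eta * (t - s))
  (fun t => lyapunov al c t + eta * t)) => //.
- by rewrite lerDl.
- apply: ac_incrementsD; apply: ac_incrementsZ => //.
    by apply: ac_incrementsD; [exact: x_ac | exact: v_ac].
  exact: ac_increments_length.
- by move=> s t s0 st tT; have := hK s t s0 st tT; lra.
apply: (negligibleS _ good_ae); apply: subsetC => t gt at_ tb e e0.
have t0 := le_trans a0 at_; have {}gt := gt t0.
have [|r r0 hr] := lyapunov_rate al c t al0 c0 t0 gt (e - eta).
  by apply: (le_lt_trans (rate t at_ tb gt)); rewrite ltrDr.
exists r => // s u as_ st tu ub us.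
by have := hr s u (le_trans a0 as_) st tu us; lra.
Qed.

(** Insert w = - (lambda x' + v') and drop - <v', x'> <= 0. *)
Lemma dissipation t : 0 <= t -> good_time t ->
  dotr (residual t) (derive1 x t) <= - (lambda * enorm (derive1 x t) ^+ 2).
Proof.
move=> t0 gt; have := velocities_monotone t t0 gt.
rewrite (residual_eq t gt) dotrNl dotrDl dotrZl sqr_enorm.
by rewrite (dotrC (derive1 v t)) lerN2 lerDl.
Qed.

Lemma energy_nonincreasing a b : 0 <= a -> a <= b -> energy b <= energy a.
Proof.
move=> a0 ab.
have lyE t : lyapunov 0 1 t + 0 * t = energy t.
  by rewrite /lyapunov !mul0r mul1r add0r addr0.
rewrite -!lyE; apply: lyapunov_decrease => // t at_ tb gt.
rewrite mul0r add0r mul1r oppr0.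
apply: (le_trans (dissipation t (le_trans a0 at_) gt)).
by rewrite oppr_le0 mulr_ge0 ?exprn_ge0 ?enorm_ge0 ?(ltW lambda_gt0).
Qed.

(** The part lambda cancels the term - lambda <w, x'> that comes from
    v' = - w - lambda x'; the part L^2 / (2 lambda) turns - lambda |x'|^2 into
    - L^2 |x'|^2 / 2, which absorbs L |w| |x'| up to |w|^2 / 2. *)
Definition lyapunov_weight : R := lambda + L ^+ 2 / (2 * lambda).

Lemma lyapunov_dissipation t : 0 <= t -> good_time t ->
  1 * (dotr (residual t) (derive1 v t) +
       L * enorm (residual t) * enorm (derive1 x t)) +
  lyapunov_weight * dotr (residual t) (derive1 x t) <=
  - (enorm (residual t) ^+ 2 / 2).
Proof.
move=> t0 gt; have := dissipation t t0 gt.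
have : derive1 v t = - residual t - lambda *: derive1 x t.
  by rewrite (residual_eq t gt) opprK addrAC subrr add0r.
move=> ->; rewrite dotrBr dotrNr dotrZr -sqr_enorm.
move: (enorm (residual t)) (enorm _) (dotr _ _) => r p d hd.
have l0 : lambda != 0 by rewrite gt_eqF.
have w0 : 0 <= L ^+ 2 / (2 * lambda).
  by rewrite divr_ge0 ?sqr_ge0// mulr_ge0// ltW.
have := ler_wpM2l w0 hd.
rewrite (_ : _ * - _ = - (L ^+ 2 * p ^+ 2 / 2)); last by field.
rewrite /lyapunov_weight mulrDl; have := sqr_ge0 (r - L * p); lra.
Qed.

(** From T0 on, the energy decreases by at most e / (4 c). If |w|^2 >= e / 2 at
    all times after T0, the Lyapunov function would decrease at rate at least
    e / 4 for ever, although it is bounded from below by c M. So |w|^2 < e / 2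
    at some t1 >= T0; afterwards
    |w|^2 / 2 <= e / 4 + c (F(t1) - F(t)) <= e / 2. *)
Lemma residual_vanishes (M e : R) :
  (forall t, 0 <= t -> M <= energy t) -> 0 < e ->
  exists2 T : R, 0 <= T & forall t, T <= t -> enorm (residual t) ^+ 2 <= e.
Proof.
move=> hM e0; set c := lyapunov_weight.
have c0 : 0 < c.
  by rewrite /c ltr_wpDr// divr_ge0 ?sqr_ge0// mulr_ge0// ltW.
pose E := [set energy t | t in [set t | 0 <= t]].
have infE : has_inf E.
  split; first by exists (energy 0), 0 => /=.
  by exists M => _ [t t0 <-]; exact: hM.
have k0 : 0 < e / (4 * c) by rewrite divr_gt0// mulr_gt0.
have [_ [T0 /= T00 <-] hT0] := inf_adherent k0 infE.
have infle t : 0 <= t -> inf E <= energy t.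
  by move=> t0; apply: ge_inf; [exact: infE.2 | exists t].
have lyapE t : lyapunov 1 c t = enorm (residual t) ^+ 2 / 2 + c * energy t.
  by rewrite /lyapunov div1r mulrC.
have [t1 T0t1 ht1] : exists2 t1, T0 <= t1 & enorm (residual t1) ^+ 2 < e / 2.
  apply: contrapT => none.
  have big t : T0 <= t -> e / 2 <= enorm (residual t) ^+ 2.
    by move=> T0t; rewrite leNgt; apply/negP => h; apply: none; exists t.
  (* A time at which a decrease at rate e / 4 has gone below c M. *)
  pose b := T0 + ((lyapunov 1 c T0 - c * M) / (e / 4) + 1).
  have lyM t : 0 <= t -> c * M <= lyapunov 1 c t.
    move=> t0; rewrite lyapE ler_wpDl ?divr_ge0 ?sqr_ge0//.
    by rewrite ler_pM2l// hM.
  have e40 : 0 < e / 4 by rewrite divr_gt0.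
  have T0b : T0 <= b.
    by rewrite lerDl addr_ge0// divr_ge0 ?subr_ge0 ?lyM// ltW.
  have := lyapunov_decrease 1 c (e / 4) T0 b ler01 (ltW c0) (ltW e40) T00 T0b.
  have : e / 4 * (b - T0) = lyapunov 1 c T0 - c * M + e / 4.
    by rewrite /b; field; rewrite gt_eqF.
  have := lyM b (le_trans T00 T0b).
  move=> h1 h2 h3; suff : False by [].
  suff /h3 : forall t, T0 <= t -> t <= b -> good_time t ->
      1 * (dotr (residual t) (derive1 v t) +
           L * enorm (residual t) * enorm (derive1 x t)) +
      c * dotr (residual t) (derive1 x t) <= - (e / 4).
    move: h1 h2; move: (lyapunov 1 c T0) (lyapunov 1 c b) => l0 lb; lra.
  move=> t T0t _ gt.
  apply: (le_trans (lyapunov_dissipation t (le_trans T00 T0t) gt)).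
  by have := big t T0t; move: (enorm _ ^+ 2) => r; lra.
have t10 := le_trans T00 T0t1.
exists t1 => // t t1t; have t0 := le_trans t10 t1t.
have decr : lyapunov 1 c t + 0 * t <= lyapunov 1 c t1 + 0 * t1.
  apply: lyapunov_decrease => //; first exact: ltW.
  move=> s t1s _ gs.
  apply: (le_trans (lyapunov_dissipation s (le_trans t10 t1s) gs)).
  by rewrite lerN2 divr_ge0// sqr_ge0.
have h1 := energy_nonincreasing T0 t1 T00 T0t1.
have h2 := infle t t0.
have gap : c * (energy t1 - energy t) <= e / 4.
  apply: (@le_trans _ _ (c * (e / (4 * c)))).
    by rewrite ler_pM2l//; move: h1 h2 hT0; lra.
  rewrite le_eqVlt; apply/orP; left; apply/eqP; field.
  by rewrite gt_eqF.
have conclude (r1 r f1 f : R) : r1 < e / 2 ->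
    r / 2 + c * f <= r1 / 2 + c * f1 -> c * (f1 - f) <= e / 4 -> r <= e.
  by lra.
move: decr; rewrite !mul0r !addr0 !lyapE => decr.
exact: (conclude _ _ _ _ ht1 decr gap).
Qed.

End Trajectory.

(** * Closedness and the Frechet subdifferential *)

Section Subdifferentials.
Context {R : realType} {n : nat}.
Implicit Types (phi : 'rV[R]_n -> \bar R) (psi : 'rV[R]_n -> R).

(** In the subgradient inequality at x_k, the affine part converges, and the
    value phi(x_k) is at least nearly phi(a) by lower semicontinuity. *)
Lemma convex_subdiff_closed phi (xs vs : nat -> 'rV[R]_n) (a b : 'rV[R]_n) :
  proper_fun phi -> lower_semicontinuous phi ->
  (forall k, convex_subdiff phi (xs k) (vs k)) ->
  xs @ \oo --> a -> vs @ \oo --> b -> convex_subdiff phi a b.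
Proof.
move=> [phiNy [y0 y0fin]] lsc sub xa vb.
have ineq y : (phi a + (dotr b (y - a))%:E <= phi y)%E.
  have [->|yfin] := eqVneq (phi y) +oo%E; first by rewrite leey.
  have /fineK <- : phi y \is a fin_num.
    by rewrite fin_numE yfin andbT gt_eqF.
  set r := fine (phi y); set s := dotr b (y - a).
  rewrite leNgt; apply/negP => lt_r.
  have {}lt_r : ((r - s)%:E < phi a)%E by rewrite EFinB lteBlDr.
  have [m lt_m m_lt] : exists2 m : R, r - s < m & (m%:E < phi a)%E.
    have := phiNy a; move: lt_r; case: (phi a) => [p| |//] lt_r _.
      exists ((r - s + p) / 2); rewrite ?lte_fin.
        by move: lt_r; rewrite lte_fin; lra.
      by move: lt_r; rewrite lte_fin; lra.
    by exists (r - s + 1); [rewrite ltrDl | rewrite ltry].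
  have [V Va hV] := lsc a m m_lt.
  have cs : dotr (vs k) (y - xs k) @[k --> \oo] --> s.
    by apply: cvg_dotr => //; apply: cvgB => //; exact: cvg_cst.
  have : \forall k \near \oo, False.
    have cVs : \forall k \near \oo, V (xs k) by exact: xa Va.
    have cds : \forall k \near \oo, r - m < dotr (vs k) (y - xs k).
      by apply: (cvgr_gt s cs); move: lt_m; lra.
    near=> k.
    have Vk : V (xs k) by near: k.
    have dk : r - m < dotr (vs k) (y - xs k) by near: k.
    have [_ /(_ y)] := sub k.
    apply/negP; rewrite -ltNge -[phi y]fineK; last first.
      by rewrite fin_numE yfin andbT gt_eqF.
    apply: (@lt_trans _ _ (m%:E + (dotr (vs k) (y - xs k))%:E)%E).
      by rewrite -EFinD lte_fin -/r; move: dk; lra.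
    by rewrite lteD2rE//; exact: hV.
  by case/filter_ex.
split=> //.
have := le_lt_trans (ineq y0) y0fin; rewrite !ltey.
by apply: contraNneq => ->; rewrite addye.
Unshelve. all: by end_near. Qed.

(** Adding the subgradient inequality of phi to the quadratic bound of psi, the
    linear terms cancel: (phi + psi)(y) >= (phi + psi)(a) - L |y - a|^2, and the
    quotient by |y - a| is at least - L |y - a|. *)
Lemma frechet_subdiff_critical phi psi (L : R) (a : 'rV[R]_n) :
  0 < L -> (forall y, differentiable psi y) -> lipschitz_grad L psi ->
  proper_fun phi -> convex_subdiff phi a (- grad psi a) ->
  frechet_subdiff (fun y => phi y + (psi y)%:E)%E a 0.
Proof.
move=> L0 dpsi lip [phiNy _] [afin sub].
have afn : phi a \is a fin_num by rewrite fin_numElt afin andbT.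
split; first by rewrite -(fineK afn) -EFinD ltry.
rewrite limf_einfE; apply/lee_addgt0Pr => e e0.
rewrite -leeBlDr// sub0e; apply: le_ereal_sup_tmp => /=.
pose V := [set y | y != a /\ enorm (y - a) < e / L].
have aV : a^' V.
  have : enorm (y - a) @[y --> a] --> enorm (a - a).
    have sub_cvg : y - a @[y --> a] --> a - a.
      exact: (@cvgB _ _ _ (nbhs a) _ id (fun=> a) a a cvg_id (cvg_cst a)).
    exact: (cvg_enorm sub_cvg).
  rewrite subrr enorm0 => /cvgr_lt /(_ (e / L) (divr_gt0 e0 L0)) h.
  by rewrite /dnbhs /within /=; apply: filterS h => y ? ?.
eexists; first by exists V.
apply: le_ereal_inf_tmp => _ [y [ya yae] <-].
have d0 : 0 < enorm (y - a).
  by rewrite lt_neqAle enorm_ge0 eq_sym enorm_eq0 subr_eq0 ya.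
rewrite dotrC dotr0 sube0.
have := sub y; have := phiNy y.
rewrite -(fineK afn); case: (phi y) => [p| |//] _; last first.
  move=> _; rewrite -EFinD -EFinN !addye// mulyr.
  by rewrite gtr0_sg ?invr_gt0// mul1e leey.
rewrite dotrNl -!EFinD -EFinM !lee_fin => hp.
rewrite ler_pdivlMr//.
have := quadratic_bound psi dpsi L y a (ltW L0) lip.
rewrite ler_norml => /andP[+ _].
have : L * enorm (y - a) ^+ 2 <= e * enorm (y - a).
  rewrite expr2 mulrA ler_pM2r//; move: yae; rewrite ltr_pdivlMr// mulrC.
  exact: ltW.
rewrite mulNr; move: hp.
move: (dotr _ _) (fine _) (L * _) (e * enorm _) => d f l1 l2.
by lra.
Qed.

Lemma frechet_limiting (f : 'rV[R]_n -> \bar R) (a w : 'rV[R]_n) :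
  frechet_subdiff f a w -> limiting_subdiff f a w.
Proof.
move=> fw; split; first by case: fw.
by exists (fun=> a), (fun=> w); split => //; exact: cvg_cst.
Qed.

End Subdifferentials.

(** * Cluster points of the trajectory are critical *)

Theorem lemma7 (R : realType) (n : nat)
    (phi : 'rV[R]_n -> \bar R) (psi : 'rV[R]_n -> R) (L lambda : R)
    (x0 v0 : 'rV[R]_n) (x v : R -> 'rV[R]_n)
    (t_ : nat -> R) (xbar : 'rV[R]_n)
    (phi_proper : proper_fun phi)
    (phi_convex : convex_efun phi)
    (phi_lsc : lower_semicontinuous phi)
    (psi_diff : forall y : 'rV[R]_n, differentiable psi y)
    (L_gt0 : 0 < L)
    (grad_lip : lipschitz_grad L psi)
    (lambda_gt0 : 0 < lambda)
    (v0_subdiff : convex_subdiff phi x0 v0)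
    (sol : strong_global_solution phi psi lambda x0 v0 x v)
    (sum_lbounded :
      exists M : R, forall y : 'rV[R]_n, (M%:E <= phi y + (psi y)%:E)%E)
    (t_ge0 : forall k : nat, 0 <= t_ k)
    (t_pinfty : t_ @ \oo --> +oo)
    (x_t_cvg : (fun k : nat => x (t_ k)) @ \oo --> xbar) :
  limiting_subdiff (fun y : 'rV[R]_n => (phi y + (psi y)%:E)%E) xbar 0.
Proof.
case: sol => -[x_ac v_ac] sub good_ae _; have L_ge0 := ltW L_gt0.
have [M hM] := sum_lbounded.
have energy_ge t : 0 <= t -> M <= energy phi psi x t.
  move=> t0; rewrite -lee_fin /energy EFinD fineK; first exact: hM.
  exact: (phi_fin phi x v phi_proper sub t t0).
have w_cvg0 : (fun k => enorm (0 - residual psi x v (t_ k))) @ \oo --> (0 : R).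
  apply/cvgrPdist_le => e e0.
  have [T T0 hT] := residual_vanishes phi psi L lambda x v phi_proper psi_diff
    L_ge0 grad_lip lambda_gt0 sub x_ac v_ac good_ae M _ energy_ge
    (exprn_gt0 2 e0).
  near=> k; rewrite !sub0r normrN enormN ger0_norm ?enorm_ge0//.
  rewrite -(@ler_pXn2r _ 2)// ?nnegrE ?enorm_ge0 ?(ltW e0)//.
  by apply: hT; near: k; move/cvgryPge : t_pinfty; exact.
have v_cvg : (fun k => v (t_ k)) @ \oo --> - grad psi xbar.
  rewrite -[X in _ --> X]add0r.
  rewrite (_ : (fun k => v (t_ k)) =
    (fun k => residual psi x v (t_ k) - grad psi (x (t_ k)))); last first.
    by apply/funext => k; rewrite /residual addrK.
  by apply: cvgB; [exact: enorm_cvg w_cvg0 | exact: (cvg_grad psi L)].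
apply: frechet_limiting.
apply: (frechet_subdiff_critical _ _ L) => //.
exact: (convex_subdiff_closed _ _ _ _ _ phi_proper phi_lsc
  (fun k => sub (t_ k) (t_ge0 k)) x_t_cvg v_cvg).
Unshelve. all: by end_near. Qed.
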